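(* Let $p$ be a prime and let $(\mathcal{A}_p,f)$ be a connected affine quandle of order $p$, where $f(x)=tx$ on $\mathbb{Z}_p$ and the order $n$ of $f$ satisfies $\gcd(n,2)=1$. For $k\in\mathcal{A}_p=\mathbb{Z}_p$ put $$A(k)=\{(i,i+tk),(i,i+t^2k),\dots,(i,i+t^nk)\mid i\in\mathcal{A}_p\}.$$ Then $\mathcal{A}_p\otimes\mathcal{A}_p/\langle\tau\rangle$ consists of $A(0)$ and $(p-1)/(2n)$ elements of the form $A(k)$; that is, besides the class of $A(0)$ it has exactly $(p-1)/(2n)$ further elements, each of which is the class of some $A(k)\in\mathcal{A}_p\otimes\mathcal{A}_p$, $k\in\mathcal{A}_p$.
   Context: A quandle is a set $X$ with a binary operation $\triangleright$ such that $x\triangleright x=x$; for all $x,y$ there is a unique $z$ with $x=z\triangleright y$ (this $z$ is denoted $x\triangleright^{-1}y$); and $(x\triangleright y)\triangleright z=(x\triangleright z)\triangleright(y\triangleright z)$. $Inn(X)$ is the group of permutations of $X$ generated by the maps $R_y(x)=x\triangleright y$; $X$ is connected if $Inn(X)$ acts transitively on $X$. For $t\in\mathbb{Z}_p^{\ast}$ and $f(x)=tx$, $(\mathcal{A}_p,f)$ is the affine quandle on $\mathbb{Z}_p$ with $x\triangleright y=tx+(1-t)y$; the order $n$ of $f$ is the least $n\in\mathbb{N}$ with $t^n\equiv1\pmod p$. Let $F(X)$ be the free group on the set $X$. It acts on $X$ on the right by $x\cdot g=((x\triangleright^{\epsilon_1}x_1)\triangleright^{\epsilon_2}x_2\cdots)\triangleright^{\epsilon_m}x_m$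 for $g=x_1^{\epsilon_1}\cdots x_m^{\epsilon_m}$ with $\epsilon_i=\pm1$, $\triangleright^{1}=\triangleright$, and on the left by $g\cdot x=x\cdot g^{-1}$. The (canonical) tensor product $X\otimes X$ is the set of equivalence classes $[(x,y)]$ of $X\times X$ under the equivalence relation generated by $(x\cdot g,y)\sim(x,g\cdot y)$ for $x,y\in X$, $g\in F(X)$. Equivalently, $X\otimes X$ is the set of orbits of $Inn(X)$ acting diagonally on $X\times X$. The map $\tau(x,y)=(y,x)$ on $X\times X$ induces an involution $\tau[(x,y)]=[(y,x)]$ of $X\otimes X$, and $X\otimes X/\langle\tau\rangle$ denotes the set of orbits of this involution on $X\otimes X$. *)

(* Defs.v *)
From HB Require Import structures.
From mathcomp Require Import all_boot all_order all_algebra all_fingroup.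
From mathcomp Require Import boolp ring.
From Stdlib Require Import Relation_Operators.

Set Implicit Arguments.
Unset Strict Implicit.
Unset Printing Implicit Defensive.

Import GRing.Theory.

Record quandle (X : finType) := Quandle {
  qop :> X -> X -> X;
  qidem : forall x, qop x x = x;
  qdiv : forall x y, exists! z, x = qop z y;
  qdistr : forall x y z, qop (qop x y) z = qop (qop x z) (qop y z) }.

Section Quandle.
Variables (X : finType) (Q : quandle X).

Lemma rtrans_inj y : injective (fun x => Q x y).
Proof.
move=> a b /= eq_ab; have [z [_ uz]] := qdiv Q (Q a y) y.
by rewrite -(uz a) // -(uz b).
Qed.

Definition rtrans y : {perm X} := perm (@rtrans_inj y).

Definition qopV x y : X := (rtrans y)^-1%g x.

Definition Inn : {group {perm X}} := <<[set rtrans y | y : X]>>%G.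

Definition connected_quandle : bool := [transitive Inn, on [set: X] | 'P].

(* The free group F(X) is represented by its reduced words; the letter       *)
(* (x, true) stands for x and (x, false) for x^-1. Only the inverse and the  *)
(* action on X are needed below, not the product.                            *)
Definition reduced (w : seq (X * bool)) : bool :=
  sorted (fun a b => ~~ ((a.1 == b.1) && (a.2 != b.2))) w.

Definition free_group : Type := {w : seq (X * bool) | reduced w}.

Definition inv_word (w : seq (X * bool)) : seq (X * bool) :=
  rev [seq (a.1, ~~ a.2) | a <- w].

Lemma inv_word_reduced w : reduced w -> reduced (inv_word w).
Proof.
rewrite /reduced /inv_word rev_sorted sorted_map; apply: sub_sorted => a b /=.
by rewrite eq_sym; case: a.2; case: b.2.
Qed.

Definition free_inv (g : free_group) : free_group :=
  exist _ (inv_word (sval g)) (inv_word_reduced (svalP g)).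

Definition ract (x : X) (g : free_group) : X :=
  foldl (fun z a => if a.2 then Q z a.1 else qopV z a.1) x (sval g).

Definition lact (g : free_group) (x : X) : X := ract x (free_inv g).

Definition tensor_step (u v : X * X) : Prop :=
  exists x y g, u = (ract x g, y) /\ v = (x, lact g y).

Definition tensor_equiv : X * X -> X * X -> Prop :=
  clos_refl_sym_trans (X * X) tensor_step.

(* The elements of the tensor product are the equivalence classes, as subsets *)
(* of X * X.                                                                  *)
Definition tensor : {set {set X * X}} :=
  equivalence_partition (fun u v => `[< tensor_equiv u v >]) [set: X * X].

Lemma swap_inj : injective (fun u : X * X => (u.2, u.1)).
Proof. by move=> [a b] [c d] /= [-> ->]. Qed.

Definition tau : {perm X * X} := perm swap_inj.

(* The involution induced on classes is the action of tau on subsets, which   *)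
(* sends the class of (x, y) to that of (y, x).                               *)
Definition tau_orbit (C : {set X * X}) : {set {set X * X}} :=
  orbit 'P^* <[tau]>%g C.

Definition tensor_mod_tau : {set {set {set X * X}}} :=
  [set tau_orbit C | C in tensor].

End Quandle.

Section Affine.
Local Open Scope ring_scope.
Variables (p : nat) (t : {unit 'F_p}).

Definition affine_op (x y : 'F_p) : 'F_p := val t * x + (1 - val t) * y.

Lemma affine_idem x : affine_op x x = x.
Proof. by rewrite /affine_op -mulrDl addrC subrK mul1r. Qed.

Lemma affine_div x y : exists! z, x = affine_op z y.
Proof.
exists ((val t)^-1 * (x - (1 - val t) * y)); split.
  by rewrite /affine_op mulVKr ?subrK ?(valP t).
by move=> z ->; rewrite /affine_op addrK mulKr ?(valP t).
Qed.

Lemma affine_distr x y z :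
  affine_op (affine_op x y) z = affine_op (affine_op x z) (affine_op y z).
Proof. by rewrite /affine_op; ring. Qed.

Definition affine_quandle : quandle 'F_p :=
  Quandle affine_idem affine_div affine_distr.

Definition affine_class (n : nat) (k : 'F_p) : {set 'F_p * 'F_p} :=
  [set (i, i + val t ^+ j.+1 * k) | i : 'F_p, j : 'I_n].

End Affine.

(* Main.v *)
Require Import Defs.
From HB Require Import structures.
From mathcomp Require Import all_boot all_order all_algebra all_fingroup.
From mathcomp Require Import boolp ring.
From Stdlib Require Import Relation_Operators.
Set Implicit Arguments.
Unset Strict Implicit.
Unset Printing Implicit Defensive.
Import GRing.Theory.

(** The inner automorphisms of the affine quandle of slope [t] are affine maps
    with slope in the cyclic group generated by [t]. Connectedness excludes
    [t = 1] ([trivial_connected]), so [1 - t] is invertible and the map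
    [x |-> t x + (1 - t) z] can be made, by a suitable choice of [z], to send any
    given point to any other one. Hence the pairs equivalent to [(x, y)] are
    exactly the pairs [(i, i + t^j (y - x))]: the difference of the coordinates, up to powers of [t], is a complete invariant
    ([tensor_equivP]), and the tensor product consists of the sets [A(k)], with
    [A(k) = A(k')] if and only if [k'] is a power of [t] times [k].

    The swap changes the sign of the difference, so it maps [A(k)] to [A(-k)],
    and the orbits of [A(k)] and [A(k')] coincide if and only if
    [k' = +- t^j k] ([tau_orbit_affine_eqP]). As [t <> 1] forces [p] to be
    odd, [-1] differs from [1], and as [n] is odd, [-1] is not a power of [t]:
    the scalars [+- t^j] with [1 <= j <= n] are [2n] distinct ones
    ([signed_power_inj]). The nonzero residues are thus cut into fibres of size
    [2n] by the map sending [k] to the orbit of [A(k)], which gives both the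
    divisibility and the count. *)

(** * Words acting on a quandle *)

Section QuandleWords.
Variables (X : finType) (Q : quandle X).

Definition letter_act (z : X) (a : X * bool) : X :=
  if a.2 then Q z a.1 else qopV Q z a.1.

Lemma rtransE x y : rtrans Q y x = Q x y.
Proof. by rewrite permE. Qed.

Lemma qopVK y : cancel (qopV Q ^~ y) (Q ^~ y).
Proof. by move=> x /=; rewrite /qopV -rtransE permKV. Qed.

Lemma qopK y : cancel (Q ^~ y) (qopV Q ^~ y).
Proof. by move=> x /=; rewrite /qopV -rtransE permK. Qed.

Lemma letter_actK y b : cancel (letter_act ^~ (y, b)) (letter_act ^~ (y, ~~ b)).
Proof. by case: b => x; rewrite /letter_act /= ?qopK ?qopVK. Qed.

Lemma inv_word_actK w :
  cancel (foldl letter_act ^~ w) (foldl letter_act ^~ (inv_word w)).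
Proof.
elim: w => [|[y b] w IHw] x //=.
by rewrite /inv_word /= rev_cons -cats1 foldl_cat /= IHw letter_actK.
Qed.

Lemma inv_wordK : involutive (@inv_word X).
Proof.
move=> w; rewrite /inv_word -map_rev revK -map_comp -[RHS]map_id.
by apply: eq_map => -[y b] /=; rewrite negbK.
Qed.

Lemma ractK g : cancel ((Defs.ract Q) ^~ g) (lact Q g).
Proof. exact: inv_word_actK. Qed.

Lemma lactK g : cancel (lact Q g) ((Defs.ract Q) ^~ g).
Proof.
move=> x; have := inv_word_actK (inv_word (sval g)) x.
by rewrite inv_wordK.
Qed.

(** The balanced relation defining the tensor product, read along one letter,
    is the diagonal action of that letter. *)
Lemma tensor_equiv_qop x y z : tensor_equiv Q (x, y) (Q x z, Q y z).
Proof.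
pose g : free_group X := exist _ [:: (z, true)] isT.
apply/rst_sym/rst_step; exists x, (Q y z), g; split=> //.
by rewrite -[Q y z]/(Defs.ract Q y g) ractK.
Qed.

(** The swap generates a group of order at most two, so each orbit is a pair. *)
Lemma tau_orbitE (C : {set X * X}) :
  tau_orbit C = [set C; [set (u.2, u.1) | u in C]].
Proof.
have tau2 : (tau X ^+ 2 = 1)%g.
  by apply/permP => -[x y]; rewrite permX /= !permE.
have act1 : [set ('P%act u (1%g : {perm X * X})) | u in C] = C.
  rewrite -[RHS]imset_id; apply: eq_imset => u /=; exact: act1.
have actt : [set ('P%act u (tau X)) | u in C] = [set (u.2, u.1) | u in C].
  by apply: eq_imset => u; rewrite /= /aperm permE.
apply/setP => D; rewrite !inE; apply/imsetP/orP.
  case=> a /cycleP[i ->] ->; rewrite (divn_eq i 2) expgD mulnC expgM tau2 expg1n mul1g.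
  rewrite modn2; case: (odd i); rewrite ?expg1 ?expg0 /= /setact.
    by right; rewrite actt.
  by left; rewrite act1.
case=> /eqP->; [exists 1%g | exists (tau X)]; rewrite ?group1 ?cycle_id //=; exact/esym.
Qed.

Lemma trivial_connected (x y : X) :
  connected_quandle Q -> (forall a b, Q a b = a) -> x = y.
Proof.
move=> conn triv.
have Inn1 : Inn Q \subset [1]%g.
  rewrite gen_subG; apply/subsetP => _ /imsetP[b _ ->]; rewrite inE.
  by apply/eqP/permP => a; rewrite permE perm1 triv.
have /orbitP[a /(subsetP Inn1)] : y \in orbit 'P (Inn Q) x.
  by rewrite (atransP conn x) ?inE.
by rewrite inE => /eqP->; rewrite act1.
Qed.

End QuandleWords.

(** * Tensor classes of an affine quandle *)

Section AffineTensor.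
Local Open Scope ring_scope.

Variables (p n : nat) (t : {unit 'F_p}).
Hypothesis t_prim : n.-primitive_root (val t).

Local Notation Q := (affine_quandle t).
Local Notation A := (affine_class t n).

Let n_gt0 : (0 < n)%N := prim_order_gt0 t_prim.

(** The sets [A(k)] are indexed by the exponents [1, ..., n]; periodicity brings
    every exponent, in particular [0], into this range. *)
Lemma power_ordS j : exists i : 'I_n, val t ^+ j = val t ^+ i.+1.
Proof.
have lt_jn : ((j + n.-1) %% n < n)%N by rewrite ltn_mod.
exists (Ordinal lt_jn); apply/eqP; rewrite (eq_prim_root_expr t_prim) /=.
by rewrite -addn1 modnDml -addnA addn1 prednK // modnDr.
Qed.

(** Positive powers of [t] include the inverses, since [t ^+ n = 1]; this is
    what makes proportionality by powers of [t] symmetric. *)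
Lemma power_inv j : exists i, forall x, val t ^+ i * (val t ^+ j * x) = x.
Proof.
exists (n * j - j)%N => x.
by rewrite mulrA -exprD subnK ?leq_pmull // exprM (prim_expr_order t_prim) expr1n mul1r.
Qed.

Lemma affine_classP k (u : 'F_p * 'F_p) :
  reflect (exists j, u.2 - u.1 = val t ^+ j * k) (u \in A k).
Proof.
apply: (iffP imset2P) => [[i j _ _ ->] | [j def_u]].
  by exists j.+1; rewrite /= addrAC subrr add0r.
have [i def_i] := power_ordS j.
by exists u.1 i => //; rewrite -def_i -def_u addrC subrK; case: (u).
Qed.

Lemma affine_opB x y z : Q x z - Q y z = val t * (x - y).
Proof. by rewrite -[LHS]/(affine_op t x z - affine_op t y z) /affine_op; ring. Qed.

Lemma ract_slope g :
  exists j, forall x y, Defs.ract Q x g - Defs.ract Q y g = val t ^+ j * (x - y).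
Proof.
rewrite /Defs.ract; elim: (sval g) => [|[z b] w [j IHw]].
  by exists 0 => x y; rewrite mul1r.
have [i ti] := power_inv 1.
case: b; [exists (j + 1)%N | exists (j + i)%N] => x y; rewrite [LHS]IHw exprD -mulrA.
  by rewrite expr1 -(affine_opB x y z).
congr (_ * _); rewrite -[LHS]ti expr1 -(affine_opB _ _ z).
by rewrite (qopVK Q z x) (qopVK Q z y).
Qed.

(** Since [y] is the image of [g . y] under [g], a generating step compares the
    pair [(x, g . y)] with its diagonal image under [g], which multiplies the
    difference of the coordinates by a power of [t]. *)
Lemma tensor_equiv_slope (u v : 'F_p * 'F_p) :
  tensor_equiv Q u v -> exists j, v.2 - v.1 = val t ^+ j * (u.2 - u.1).
Proof.
elim=> {u v} [u v [x [y [g [-> ->]]]] | u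
  | u v _ [j def_v] | u v w _ [i def_v] _ [j def_w]].
- have [j gj] := ract_slope g; have [i ti] := power_inv j; exists i => /=.
  by rewrite -{2}(lactK Q g y) gj ti.
- by exists 0; rewrite mul1r.
- by have [i ti] := power_inv j; exists i; rewrite def_v ti.
by exists (j + i)%N; rewrite def_w def_v mulrA exprD.
Qed.

Hypothesis t_neq1 : val t != 1.
Hypothesis p_prime : prime p.

(** Solving [t x + (1 - t) z = i] for [z] lets one letter both move the first
    coordinate anywhere and multiply the difference by [t]. *)
Lemma tensor_equiv_power (x y i : 'F_p) j :
  tensor_equiv Q (x, y) (i, i + val t ^+ j.+1 * (y - x)).
Proof.
have move_one (a b c : 'F_p) : tensor_equiv Q (a, b) (c, c + val t * (b - a)).
  pose z := (1 - val t)^-1 * (c - val t * a).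
  have def_c : affine_op t a z = c.
    by rewrite /affine_op /z mulVKf ?subr_eq0 1?eq_sym // addrC subrK.
  have -> : c + val t * (b - a) = affine_op t b z.
    by rewrite -{1}def_c /affine_op; ring.
  by rewrite -{1}def_c; apply: tensor_equiv_qop.
elim: j i => [|j IHj] i; first by rewrite expr1.
apply: rst_trans (IHj i) _.
have := move_one i (i + val t ^+ j.+1 * (y - x)) i.
by rewrite addrAC subrr add0r mulrA -exprS.
Qed.

Lemma tensor_equivP (x y : 'F_p) (v : 'F_p * 'F_p) :
  tensor_equiv Q (x, y) v <-> v \in A (y - x).
Proof.
split=> [/tensor_equiv_slope eq_v | /imset2P[i j _ _ ->]].
  exact/affine_classP.
exact: tensor_equiv_power.
Qed.

Lemma tensor_classE (x y : 'F_p) :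
  [set v in setT | `[< tensor_equiv Q (x, y) v >]] = A (y - x).
Proof.
by apply/setP => v; rewrite !inE; apply/asboolP/idP => /tensor_equivP.
Qed.

Lemma tensorP C : reflect (exists k, C = A k) (C \in tensor Q).
Proof.
apply: (iffP imsetP) => [[[x y] _ ->] | [k ->]].
  by exists (y - x); rewrite -tensor_classE.
by exists (0, k) => //; rewrite tensor_classE subr0.
Qed.

Lemma affine_class_in k : A k \in tensor Q.
Proof. by apply/tensorP; exists k. Qed.

(** As [A k] is the equivalence class of [(0, k)], two such sets are equal as soon
    as they are related by one element. *)
Lemma affine_class_eqP k k' :
  reflect (exists j : 'I_n, k' = val t ^+ j.+1 * k) (A k == A k').
Proof.
have mem0 a b : ((0, b) \in A a) <-> tensor_equiv Q (0, a) (0, b).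
  by rewrite -{1}[a]subr0; split=> /tensor_equivP.
apply: (iffP eqP) => [eqA | [j def_k']].
  have /affine_classP[j] : (0, k') \in A k by rewrite eqA mem0; apply: rst_refl.
  by rewrite subr0; have [i ->] := power_ordS j; exists i.
have eq_kk' : tensor_equiv Q (0, k) (0, k').
  by apply/mem0/affine_classP; exists j.+1; rewrite subr0.
apply/setP => v; rewrite -[k]subr0 -[k']subr0.
apply/idP/idP => /tensor_equivP eq_v; apply/tensor_equivP.
  exact: rst_trans (rst_sym _ _ _ _ eq_kk') eq_v.
exact: rst_trans eq_kk' eq_v.
Qed.

(** * Counting the orbits of the swap *)

Lemma swap_affine_class k : [set (u.2, u.1) | u in A k] = A (- k).
Proof.
apply/setP => -[x y]; apply/imsetP/affine_classP.
  case=> u /affine_classP[j def_u] [-> ->].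
  by exists j; rewrite mulrN -def_u opprB.
case=> j /= def_u.
exists (y, x) => //; apply/affine_classP; exists j => /=.
by rewrite -opprB def_u mulrN opprK.
Qed.

Definition signed_power (bj : bool * 'I_n) : 'F_p :=
  (-1) ^+ bj.1 * val t ^+ bj.2.+1.

Lemma tau_orbit_affine_eqP k k' :
  reflect (exists bj, k' = signed_power bj * k) (tau_orbit (A k) == tau_orbit (A k')).
Proof.
rewrite eq_sym (sameP eqP orbit_eqP) -/(tau_orbit _) tau_orbitE swap_affine_class !inE.
rewrite ![A k' == _]eq_sym; apply: (iffP orP) => [[] /affine_class_eqP[j ->] | [[[] j] ->]].
- by exists (false, j); rewrite /signed_power mul1r.
- by exists (true, j); rewrite /signed_power expr1 mulN1r mulNr mulrN.
- right; apply/affine_class_eqP; exists j.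
  by rewrite /signed_power expr1 mulN1r mulNr mulrN.
by left; apply/affine_class_eqP; exists j; rewrite /signed_power mul1r.
Qed.

Hypothesis n_odd : gcdn n 2 = 1%N.

(** If [-1 = 1] then [p = 2], and [1] is the only unit modulo [2], against
    [t <> 1]. *)
Lemma neg1_neq1 : (-1 : 'F_p) != 1.
Proof.
apply/negP => /eqP neg1; have : (2%:R : 'F_p) == 0.
  by rewrite mulr2n -{1}neg1 addNr.
rewrite -(dvdn_pcharf (pchar_Fp p_prime)) dvdn_prime2 // => /eqP p2.
move: t_neq1 (valP t); rewrite unitfE /=; move: (val t); rewrite p2 => x.
by case: x => [[|[|x]]].
Qed.

(** Raising to the odd power [n] kills the power of [t] and keeps the sign. *)
Lemma signed_power_inj : injective signed_power.
Proof.
have odd_n : odd n by move: n_odd; rewrite gcdnC => /eqP; rewrite -/(coprime 2 n) coprime2n.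
have pow_n b j : signed_power (b, j) ^+ n = (-1) ^+ b.
  rewrite /signed_power exprMn exprAC -(signr_odd _ n) odd_n expr1.
  by rewrite exprAC (prim_expr_order t_prim) expr1n mulr1.
move=> [b i] [c j] eq_bc.
have eq_sign : (-1) ^+ b = (-1) ^+ c :> 'F_p by rewrite -(pow_n b i) eq_bc pow_n.
have def_c : b = c.
  have neg1_eq1 : (-1 : 'F_p) = 1 -> b = c by move/eqP; rewrite (negPf neg1_neq1).
  by case: (b) (c) eq_sign neg1_eq1 => -[] // eq_sign; apply;
    [exact: eq_sign | exact: esym eq_sign].
rewrite -{}def_c in eq_bc *; move: eq_bc; rewrite /signed_power /= => /(mulfI _).
rewrite signr_eq0 => /(_ isT)/eqP; rewrite (eq_prim_root_expr t_prim).
rewrite -[i.+1]add1n -[j.+1]add1n eqn_modDl !modn_small // => /eqP/val_inj.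
by move->.
Qed.

(** The fibre through [k] is the injective image of the [2n] signed exponents
    under [bj |-> signed_power bj * k]. *)
Lemma card_tau_orbit_fiber k : k != 0 ->
  #|[set k' | k' != 0 & tau_orbit (A k') == tau_orbit (A k)]| = (2 * n)%N.
Proof.
move=> k_neq0; have <- : #|{: bool * 'I_n}| = (2 * n)%N.
  by rewrite card_prod card_bool card_ord.
rewrite -(card_imset _ (inj_comp (mulIf k_neq0) signed_power_inj)).
apply: eq_card => k'; rewrite inE [_ == tau_orbit (A k)]eq_sym.
apply/andP/imsetP => /= [[_ /tau_orbit_affine_eqP[bj ->]] | [bj _ ->]]; first by exists bj.
split; last by apply/tau_orbit_affine_eqP; exists bj.
by rewrite mulf_neq0 // /signed_power mulf_neq0 ?signr_eq0 ?expf_neq0 -?unitfE ?(valP t).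
Qed.

Lemma tensor_mod_tauE :
  tensor_mod_tau Q :\ tau_orbit (A 0) = [set tau_orbit (A k) | k in [set~ 0]].
Proof.
apply/setP => c; rewrite !inE; apply/andP/imsetP.
  case=> c_neq /imsetP[_ /tensorP[k ->] def_c].
  exists k => //; rewrite !inE; apply: contra c_neq => /eqP k0.
  by rewrite def_c k0.
case=> k; rewrite !inE => k_neq0 ->; split; last by apply: imset_f; apply: affine_class_in.
rewrite eq_sym; apply: contra k_neq0 => /tau_orbit_affine_eqP[bj ->].
by rewrite mulr0.
Qed.

Lemma card_tensor_mod_tau :
  (p - 1 = #|tensor_mod_tau Q :\ tau_orbit (A 0%R)| * (2 * n))%N.
Proof.
have -> : (p - 1 = #|[set~ (0%R : 'F_p)]|)%N by rewrite cardsC1 card_Fp // subn1.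
rewrite tensor_mod_tauE -sum1_card.
rewrite (partition_big_imset (fun k => tau_orbit (A k))) /= -sum_nat_const.
apply: eq_bigr => _ /imsetP[k k_neq0 ->]; rewrite !inE in k_neq0.
by rewrite -(card_tau_orbit_fiber k_neq0) -sum1_card; apply: eq_bigl => k'; rewrite !inE.
Qed.

End AffineTensor.

Theorem theorem7p10 (p : nat) (t : {unit 'F_p}) (n : nat)
  (p_prime : prime p)
  (conn : connected_quandle (affine_quandle t))
  (ord_t : (n.-primitive_root (val t))%R)
  (n_odd : gcdn n 2 = 1) :
  let Q := affine_quandle t in
  let A := affine_class t n in
  [/\ A 0%R \in tensor Q,
      2 * n %| p - 1,
      #|tensor_mod_tau Q :\ tau_orbit (A 0%R)| = (p - 1) %/ (2 * n) &
      forall c, c \in tensor_mod_tau Q :\ tau_orbit (A 0%R) ->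
        exists2 k, A k \in tensor Q & c = tau_orbit (A k)].
Proof.
have t_neq1 : (val t != 1)%R.
  apply/eqP => t1; have eq01 : (0 = 1 :> 'F_p)%R.
    apply: trivial_connected conn _ => a b.
    by rewrite /= /affine_op t1 subrr mul0r addr0 mul1r.
  by move/eqP: eq01; rewrite eq_sym oner_eq0.
have card_eq := card_tensor_mod_tau ord_t t_neq1 p_prime n_odd.
have n_gt0 := prim_order_gt0 ord_t.
split=> [||| c].
- exact: affine_class_in.
- by rewrite card_eq dvdn_mull.
- by rewrite [in RHS]card_eq mulnK // muln_gt0.
rewrite tensor_mod_tauE // => /imsetP[k _ ->].
by exists k => //; apply: affine_class_in.
Qed.
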